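(* Let $P$ be a finite bounded poset with a quasi-$CL$-labeling $\lambda$ such that no maximal chain $\mathbf c$ of $P$ has more than two repeated labels in a row (that is, no three consecutive cover relations of $\mathbf c$ receive the same label). Then the order complex $\vert P\vert$ is vertex-decomposable.
   Context: $\vert P\vert$ is the simplicial complex of chains of $P\setminus\{\hat0,\hat1\}$. A chain-edge labeling assigns labels from a totally ordered set to cover relations $u\lessdot v$ together with a root (a maximal chain of $[\hat0,u]$); labels along a maximal chain $\mathbf c$ are taken with roots along $\mathbf c$. For an interval $[x,y]$ with root $\mathbf r$, maximal chains of $[x,y]$ get label sequences (each cover rooted by $\mathbf r$ followed by the chain below) compared lexicographically; weakly ascending means weakly increasing labels. A quasi-$CL$-labeling: for every interval $[x,y]$ and root $\mathbf r$ there is a chain $\mathbf a=\{x=a_0<\dots<a_k=y\}$ such that (i) every weakly ascending maximal chain of $[x,y]$ contains $\mathbf a$; (ii) for each $i$ all cover relations $u\lessdot v$ with $a_{i-1}\le u\lessdot v\le a_i$ receive a common label $\alpha_i$ (rooted by $\mathbf r$ followed by a maximal chain of $[x,u]$ through $a_0,\dots,a_{i-1}$); (iii) maximal chains containing $\mathbf a$ are strictly lexicographically earlier than those not containing $\mathbf a$. A complex is vertex-decomposable if it is a simplex or has a vertex $v$ such that for each face $\sigma\ni v$ there is a vertex $w\notin\sigma$ with $(\sigma\setminus v)\cup w$ a face, and both the deletion of $v$ and $\operatorname{link}v$ are vertex-decomposable.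
   Formalization: The definition of quasi-CL-labeling is read with the added requirement that every rooted interval [x,y] has at least one weakly ascending maximal chain; without it two disjoint chains of length 3 labeled 1,2,1 and 2,2,1 give a counterexample. *)

(* Defs.v *)
From HB Require Import structures.
From mathcomp Require Import all_boot all_order.

Set Implicit Arguments.
Unset Strict Implicit.
Unset Printing Implicit Defensive.

Import Order.Theory.

Local Open Scope order_scope.

Section SimplicialComplexes.
Variable V : finType.
Implicit Types (D : {set {set V}}) (F : {set V}) (v w : V).

(* The empty face belongs to every complex. A vertex is a v whose singleton is
   a face; elements of V need not be vertices. *)
Definition simplicial_complex D : Prop :=
  set0 \in D /\ (forall F G : {set V}, G \in D -> F \subset G -> F \in D).

Definition deletion D v : {set {set V}} := [set F in D | v \notin F].

Definition link D v : {set {set V}} := [set F in D | v \notin F & v |: F \in D].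

Definition shedding D v : Prop :=
  forall F, F \in D -> v \in F ->
    exists w, [/\ [set w] \in D, w \notin F & w |: (F :\ v) \in D].

(* powerset set0 = [set set0] counts as a simplex (of dimension -1). *)
Inductive vertex_decomposable : {set {set V}} -> Prop :=
| VD_simplex F : vertex_decomposable (powerset F)
| VD_shed D v :
    simplicial_complex D -> [set v] \in D -> shedding D v ->
    vertex_decomposable (deletion D v) -> vertex_decomposable (link D v) ->
    vertex_decomposable D.

End SimplicialComplexes.

Section Posets.
Variables (d : Order.disp_t) (P : finTBPOrderType d).
Implicit Types (x y u v : P) (r s a : seq P).

Definition order_complex : {set {set P}} :=
  [set C : {set P} | [&& \bot \notin C, \top \notin C &
                      [forall x in C, forall y in C, x >=< y]]].

Definition covers : rel P := [rel u v | (u < v) && ~~ [exists z, u < z < v]].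

(* As in path.v, a chain x = c_0 < c_1 < .. < c_k is represented by its bottom
   x and the sequence [:: c_1; ..; c_k] of its other elements, so that chains
   are composed by concatenation. *)
Definition chain_from_to x y a := path <%O x a && (last x a == y).

Definition max_chain x y s := path covers x s && (last x s == y).

Definition root x r := max_chain \bot x r.

Section Labelings.
Variables (dL : Order.disp_t) (L : orderType dL).

(* lam r v is the label of the cover relation u <. v with root r, where the
   root determines u = last \bot r. Only the values for which r is a root of u
   and u <. v are ever used. *)
Definition chain_edge_labeling := seq P -> P -> L.

Variable lam : chain_edge_labeling.

(* The label sequence of the chain s of [x, y], where r is a root of x. *)
Fixpoint labels r s : seq L :=
  if s is v :: s' then lam r v :: labels (rcons r v) s' else [::].

Definition weakly_ascending r s := sorted <=%O (labels r s).

(* Dictionary order: a proper prefix is earlier. *)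
Definition lex_earlier r s t :=
  ((labels r s : seqlexi L) < (labels r t : seqlexi L))%O.

(* The first clause makes explicit that [x, y] has weakly ascending maximal
   chains, as for CL-labelings. If there were none, the second clause would say
   nothing: the poset made of two disjoint chains \bot < p < q < \top and
   \bot < p' < q' < \top labeled 1,2,1 and 2,2,1 would satisfy the other
   clauses (take for a the lexicographically first maximal chain), although its
   order complex is a disjoint union of two edges.
   In the third clause, nth x (x :: a) i is a_i and nth x a i is a_(i+1). *)
Definition quasi_CL_labeling : Prop :=
  forall x y r, x <= y -> root x r ->
  exists a, chain_from_to x y a /\
    [/\ exists s, max_chain x y s && weakly_ascending r s,
        forall s, max_chain x y s -> weakly_ascending r s ->
          {subset x :: a <= x :: s},
        forall i, (i < size a)%N -> exists alpha : L,
          forall u v t,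
            nth x (x :: a) i <= u -> covers u v -> v <= nth x a i ->
            max_chain x u t -> {subset take i.+1 (x :: a) <= x :: t} ->
            lam (r ++ t) v = alpha &
        forall s t, max_chain x y s -> max_chain x y t ->
          {subset x :: a <= x :: s} -> ~ {subset x :: a <= x :: t} ->
          lex_earlier r s t].

Definition no_three_repeated_labels : Prop :=
  forall c, max_chain \bot \top c ->
  forall l : L, ~~ infix [:: l; l; l] (labels [::] c).

End Labelings.
End Posets.

(* Main.v *)
Require Import Defs.
From mathcomp Require Import all_boot all_order.

Set Implicit Arguments.
Unset Strict Implicit.
Unset Printing Implicit Defensive.

Import Order.Theory.

Local Open Scope order_scope.

(** Sort the atoms above a rooted element [x] by their labels and, among equal
    labels, put first those lying above an atom that precedes [x] one level
    below. This is a recursive atom ordering. Indeed, let [a] cover [x] and [z]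
    cover [a]. If the labels descend along [x < a < z], then [z] lies above an
    atom with a smaller label than [a]; if they ascend strictly, all other atoms
    below [z] have larger labels; if they are equal, the tie-breaking rule
    decides. The bound on repeated labels is used when two atoms [a], [b] with
    the same label have a common upper bound [y] and [a] continues by a weakly
    ascending chain: the first section [[x, c]] of the chain attached to [[x, y]]
    then lies above both and has constant labels, so [c] covers [a].

    A poset with a recursive atom ordering is vertex-decomposable, by the
    argument of Björner and Wachs: starting from [\bot], pass repeatedly to
    the last atom until reaching a [v] all of whose covers lie above an earlier
    atom. Then [v] is a shedding vertex, and both removing [v] and restricting to
    the elements comparable with [v] preserve recursive atom orderings. *)

(** * Recursive atom orderings of subposets *)

Section RecursiveAtomOrderings.
Variables (d : Order.disp_t) (P : finTBPOrderType d).
Implicit Types (S : {set P}) (x y z a b v w : P) (s t r B : seq P).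

Definition atoms S x : {set P} :=
  [set z in S | (x < z) && [forall w in S, ~~ (x < w < z)]].

Lemma atomsP S x z :
  reflect [/\ z \in S, x < z & forall w, w \in S -> x < w -> ~~ (w < z)]
          (z \in atoms S x).
Proof.
rewrite inE; apply: (iffP and3P) => -[zS xz H]; split=> //.
  by move=> w wS xw; have /implyP/(_ wS) := forallP H w; rewrite xw.
by apply/forallP=> w; apply/implyP=> wS; apply/negP=> /andP[/(H _ wS)/negP].
Qed.

Lemma atom_below S x y :
  y \in S -> x < y -> exists2 z, z \in atoms S x & z <= y.
Proof.
have [n] := ubnP #|[set w in S | x < w < y]|.
elim: n y => // n IHn y le_n yS xy.
have [Ay|/negP nAy] := boolP (y \in atoms S x); first by exists y.
have [w /and3P[wS xw wy]] : exists w, [&& w \in S, x < w & w < y].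
  apply/existsP; apply: contra_notT nAy => /existsPn H.
  by apply/atomsP; split=> // w wS xw; have := H w; rewrite wS xw.
have [|z Az zw] := IHn w _ wS xw; last first.
  by exists z => //; apply: le_trans zw (ltW wy).
rewrite ltnS in le_n; apply: leq_trans le_n; apply/proper_card/properP; split.
  by apply/subsetP=> u; rewrite !inE => /and3P[-> -> /lt_trans->].
by exists w; rewrite !inE ?ltxx ?andbF // wS xw wy.
Qed.

Lemma atoms_antichain S x a b : a \in atoms S x -> b \in atoms S x ->
  a <= b -> a = b.
Proof.
move=> /atomsP[aS xa _] /atomsP[_ _ H]; rewrite le_eqVlt => /predU1P[//|ab].
by have := H a aS xa; rewrite ab.
Qed.

Definition above B z := has (fun b => b < z) B.

(* A recursive atom ordering of the part of S above x, in which moreover the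
   atoms above some element of B come first. The elements of B play the role
   of the atoms preceding x in the ordering one level below. *)
Inductive rao S : P -> seq P -> Prop :=
  Rao x B s of uniq s & s =i atoms S x
    & (forall s1 a s2, s = s1 ++ a :: s2 -> above B a -> all (above B) s1)
    & (forall s1 a s2, s = s1 ++ a :: s2 -> rao S a s1)
    & (forall s1 a s2, s = s1 ++ a :: s2 ->
        forall b y, b \in s1 -> y \in S -> b < y -> a < y ->
        exists2 z, z \in atoms S a & (z <= y) && above s1 z)
  : rao S x B.

Lemma eq_atoms S S' x :
  (forall y, x < y -> (y \in S) = (y \in S')) -> atoms S x = atoms S' x.
Proof.
move=> E; apply/setP=> z; apply/atomsP/atomsP=> -[zS xz H].
  by split=> //; [rewrite -E|move=> w wS xw; apply: H; rewrite ?E].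
by split=> //; [rewrite E|move=> w wS xw; apply: H; rewrite -?E].
Qed.

(** An ordering at [x] only sees elements above [x], so it survives a change of [S] elsewhere, such
    as the deletion of an element that is not above [x]. *)
Lemma eq_rao S S' x B :
  (forall y, x < y -> (y \in S) = (y \in S')) -> rao S x B -> rao S' x B.
Proof.
move=> E H; elim: H E => {}x {}B s Us sA sB _ IH sC E.
have E' a (sa : a \in s) y : a < y -> (y \in S) = (y \in S').
  by move: sa; rewrite sA => /atomsP[_ xa _] /(lt_trans xa)/E.
have sM s1 a s2 : s = s1 ++ a :: s2 -> a \in s.
  by move=> ->; rewrite mem_cat mem_head orbT.
apply: (Rao (s := s)) => //.
- by move=> z; rewrite sA (eq_atoms E).
- by move=> s1 a s2 ss; exact: IH (ss) (E' _ (sM _ _ _ ss)).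
move=> s1 a s2 ss b y bs1 yS b_y ay.
rewrite -(eq_atoms (E' _ (sM _ _ _ ss))).
by apply: (sC _ _ _ ss _ _ bs1 _ b_y ay); rewrite (E' _ (sM _ _ _ ss)).
Qed.

(** * Deleting an element, and restricting to its comparables *)

Definition comparables S v : {set P} := [set y in S | (y != v) && (y >=< v)].

(* In the last clause, w can replace v in any chain whose next element above v
   is y. *)
Definition sheddable S x B v : Prop :=
  [/\ [/\ v \in S, x < v, v < \top & ~~ above B v],
      rao (S :\ v) x B, rao (comparables S v) x [::] &
      forall y, y \in S -> v < y -> exists w,
        [/\ w \in S, x < w < y, ~~ (v >=< w)
          & forall u, u \in S -> x < u -> u < v -> u < w]].

Lemma comparables_atom S x v :
  v \in atoms S x -> forall y, x < y -> (y \in comparables S v) = (y \in S) && (v < y).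
Proof.
case/atomsP=> vS xv H y xy; rewrite inE; case: (boolP (y \in S)) => //= yS.
rewrite /Order.comparable le_eqVlt (negPf (H y yS xy)) orbF lt_neqAle eq_sym.
by case: eqVneq.
Qed.

(** Nothing of [S] lies strictly between [x] and [v], so the part of [comparables S v] above [x] is
    the part of [S] above [v], and the ordering at [v] can be reused. The preference for atoms above
    [B] is dropped. *)
Lemma rao_comparables_atom S x v B :
  v \in atoms S x -> rao S v B -> rao (comparables S v) x [::].
Proof.
move=> Av H; have CE := comparables_atom Av; have /atomsP[vS xv _] := Av.
have CE' y : v < y -> (y \in S) = (y \in comparables S v).
  by move=> vy; rewrite CE ?(lt_trans xv) // vy andbT.
case: H CE' => {}v {}B s Us sA sB sR sC CE' in Av CE vS xv *.
have lts s1 a s2 : s = s1 ++ a :: s2 -> v < a.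
  move=> ss; have : a \in s by rewrite ss mem_cat mem_head orbT.
  by rewrite sA => /atomsP[].
have E' a (va : v < a) y : a < y -> (y \in S) = (y \in comparables S v).
  by move=> /(lt_trans va)/CE'.
apply: (Rao (s := s)) => //.
- move=> z; rewrite sA; apply/atomsP/atomsP=> -[].
    move=> zS vz Hz; split; rewrite -?CE' // ?(lt_trans xv) // => w wS xw.
    by move: wS; rewrite CE // => /andP[wS vw]; apply: Hz.
  move=> zC xz Hz; move: (zC); rewrite CE // => /andP[zS vz]; split=> // w wS vw.
  by apply: Hz; rewrite -?CE' ?(lt_trans xv).
- by move=> s1 a s2 ss; apply: eq_rao (sR _ _ _ ss); apply: E' (lts _ _ _ ss).
move=> s1 a s2 ss b y bs1 yS b_y ay; rewrite -(eq_atoms (E' _ (lts _ _ _ ss))).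
by apply: (sC _ _ _ ss _ _ bs1 _ b_y ay); rewrite (E' _ (lts _ _ _ ss)).
Qed.

Lemma rao_single_atom S x a :
  atoms S x =i [:: a] -> rao S a [::] -> rao S x [::].
Proof.
move=> A H.
have E s1 b s2 : [:: a] = s1 ++ b :: s2 -> s1 = [::] /\ b = a.
  by case: s1 => [[->]|c [|e s1]].
apply: (Rao (s := [:: a])) => //.
  by move=> s1 b s2 /E[-> ->].
by move=> s1 b s2 /E[-> _].
Qed.

(** The hypothesis ensures that no element above [v] becomes an atom once [v] is gone: another
    element of [S] still separates it from [x]. *)
Lemma atomsD1 S x v :
  (forall y, y \in S -> v < y -> exists2 w, w \in S :\ v & x < w < y) ->
  atoms (S :\ v) x = atoms S x :\ v.
Proof.
move=> H; apply/setP=> z; rewrite in_setD1.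
apply/atomsP/andP=> [[]|[zv /atomsP[zS xz Hz]]].
  rewrite in_setD1 => /andP[zv zS] xz Hz; split=> //; apply/atomsP; split=> //.
  move=> w wS xw; have [->|wv] := eqVneq w v; last by apply: Hz; rewrite ?in_setD1 ?wv.
  apply/negP=> /(H _ zS)[u uS /andP[xu uz]].
  by have := Hz u uS xu; rewrite uz.
split=> //; first by rewrite in_setD1 zv.
by move=> w; rewrite in_setD1 => /andP[_]; apply: Hz.
Qed.

(* Follow the last atom upwards as long as it covers no earlier atom. *)
Lemma rao_shed S x B : \top \in S -> rao S x B ->
  (forall b y, b \in B -> y \in S -> b < y -> x < y ->
     exists2 z, z \in atoms S x & (z <= y) && above B z) ->
  [\/ all (above B) (enum (atoms S x)),
      exists v, sheddable S x B v |
      forall y z, y \in S -> z \in S -> x < y -> x < z -> y >=< z].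
Proof.
move=> topS; elim=> {}x {}B s.
case/lastP: s => [|s1 a] Us sA sB sR IH sC HB.
  by apply: Or31; apply/allP=> z; rewrite mem_enum -sA.
have ss : rcons s1 a = s1 ++ a :: [::] by rewrite cats1.
(* The atoms above [B] come first, so if the last atom is one of them, all are. *)
have [aB|aB] := boolP (above B a).
  apply: Or31; apply/allP=> z; rewrite mem_enum -sA mem_rcons inE => /predU1P[->//|].
  exact/allP/(sB _ _ _ ss).
have Aa : a \in atoms S x by rewrite -sA mem_rcons mem_head.
have As1 b : b \in s1 -> b \in atoms S x by move=> bs; rewrite -sA mem_rcons inE bs orbT.
have nas1 : a \notin s1 by move: Us; rewrite rcons_uniq => /andP[].
have Us1 : uniq s1 by move: Us; rewrite rcons_uniq => /andP[].
have /atomsP[aS xa Ha] := Aa.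
have atom_le u : u \in S -> x < u -> a <= u \/ exists2 b, b \in s1 & b <= u.
  move=> uS xu; have [z] := atom_below uS xu.
  by rewrite -sA mem_rcons inE => /predU1P[->|zs] zu; [left|right; exists z].
have atom_lt u v : ~~ above s1 v -> u \in S -> x < u -> u < v -> a <= u.
  move=> /hasPn nv uS xu uv; have [//|[b bs bu]] := atom_le u uS xu.
  by have := nv b bs; rewrite (le_lt_trans bu uv).
have bC b : b \in s1 -> ~~ (a >=< b).
  move=> bs; apply/negP; have ba : b != a by apply: contraNneq nas1 => <-.
  case/orP=> [/(atoms_antichain Aa (As1 b bs))|/(atoms_antichain (As1 b bs) Aa)] E;
  by rewrite E eqxx in ba.
have s1_split t1 c t2 : s1 = t1 ++ c :: t2 -> rcons s1 a = t1 ++ c :: rcons t2 a.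
  by move=> ->; rewrite rcons_cat.
have s_split t1 c t2 : rcons s1 a = t1 ++ c :: t2 ->
    (t1 = s1 /\ c = a) \/ exists t3, s1 = t1 ++ c :: t3.
  case/lastP: t2 => [|t2 e]; first by rewrite cats1 => /rcons_inj[-> ->]; left.
  by rewrite -rcons_cons -rcons_cat => /rcons_inj[-> _]; right; exists t2.
(* Since [v] lies above no atom of [s1], deleting it leaves the orderings at those atoms intact, and
   every element of [S] strictly between [x] and [v] is at least [a]. *)
have shed_above v : sheddable S a s1 v -> sheddable S x B v.
  case=> -[vS av vT nv] rD rC shv; have xv := lt_trans xa av.
  have rb b (bs : b \in s1) y : b < y -> (y \in S) = (y \in S :\ v).
    move=> b_y; rewrite in_setD1; case: eqVneq => // E.
    by move/hasPn: nv => /(_ b bs); rewrite -E b_y.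
  have Avs : atoms (S :\ v) x = atoms S x :\ v.
    apply: atomsD1 => y yS vy; exists a; last by rewrite xa (lt_trans av vy).
    by rewrite in_setD1 aS (lt_eqF av).
  have nAv : v \notin atoms S x by apply/atomsP=> -[_ _ /(_ a aS xa)]; rewrite av.
  split.
  - split=> //; apply/hasP=> -[b bB b_v].
    (* The atom [z] below [v] and above [B] cannot be [a], which is not above [B]. If it were in
       [s1] it would have to equal [v], but [v] is not an atom because [a < v]. *)
    have [z] := HB b v bB vS b_v xv; rewrite -sA mem_rcons inE => /predU1P[->|zs].
      by rewrite (negPf aB) andbF.
    case/andP=> zv _; move/hasPn: nv => /(_ z zs); rewrite lt_neqAle zv andbT negbK.
    by move/eqP=> E; move: nAv; rewrite -E As1.
  - apply: (Rao (s := rcons s1 a)) => //.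
    + by move=> z; rewrite sA Avs in_setD1; case: eqVneq => // ->; apply/negbTE.
    + move=> t1 c t2 /s_split[[-> ->]//|[t3 E]].
      apply: eq_rao (sR _ _ _ (s1_split _ _ _ E)); apply: rb.
      by rewrite E mem_cat mem_head orbT.
    move=> t1 c t2 E b y bt yS b_y cy.
    have yS' : y \in S by move: yS; rewrite in_setD1 => /andP[].
    have [z Az /andP[zy zt]] := sC _ _ _ E b y bt yS' b_y cy.
    exists z; rewrite ?zy //; case: (s_split _ _ _ E) => [[Et Ec]|[t3 E3]].
      move: Az => /atomsP[zS cz Hz]; apply/atomsP; split=> //.
        rewrite in_setD1 zS andbT; apply: contraNneq nv => <-; by rewrite -Et.
      by move=> w; rewrite in_setD1 => /andP[_]; apply: Hz.
    rewrite -(eq_atoms (S := S)) //; apply: rb.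
    by rewrite E3 mem_cat mem_head orbT.
  (* Every element comparable with [v] and above [x] is at least [a], so [a] is the only atom
     here. *)
  - apply: rao_single_atom rC => z; rewrite mem_seq1.
    have aC : a \in comparables S v.
      by rewrite inE aS (lt_eqF av) /Order.comparable (ltW av).
    have Ca u : u \in comparables S v -> x < u -> a <= u.
      rewrite inE => /and3P[uS uv /orP[uv'|vu]] xu.
        by apply: (atom_lt u v); rewrite // lt_neqAle uv.
      exact: le_trans (ltW av) vu.
    apply/atomsP/eqP=> [[zC xz Hz]|->].
      have := Ca z zC xz; rewrite le_eqVlt => /predU1P[//|az].
      by have := Hz a aC xa; rewrite az.
    split=> // w wC xw; apply/negP=> /lt_geF; by rewrite Ca.
  move=> y yS vy; have [w [wS /andP[aw wy] vw lw]] := shv y yS vy.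
  exists w; split=> //; first by rewrite (lt_trans xa aw).
  move=> u uS xu uv; have := atom_lt u v nv uS xu uv.
  by rewrite le_eqVlt => /predU1P[<-//|au]; apply: lw.
have [aT|aT] := eqVneq a \top.
  apply: Or33 => y z yS zS xy xz.
  have E u : u \in S -> x < u -> u = \top.
    move=> uS xu; have [|[b bs bu]] := atom_le u uS xu.
      by rewrite aT le1x => /eqP.
    by have := bC b bs; rewrite aT /Order.comparable lex1 orbT.
  by rewrite (E y) // (E z) // comparablexx.
have {}aT : a < \top by rewrite lt_neqAle aT lex1.
(* An earlier atom below [y] can replace [a] in a chain, and [s1] orders the atoms that remain after
   [a] is deleted. *)
have shed_a : all (above s1) (enum (atoms S a)) -> sheddable S x B a.
  move=> allA; have Aa' y : y \in S -> a < y -> exists2 b, b \in s1 & b < y.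
    move=> yS ay; have [z Az zy] := atom_below yS ay.
    have /hasP[b bs bz] : above s1 z by apply: (allP allA); rewrite mem_enum.
    by exists b => //; apply: lt_le_trans zy.
  have ra b (bs : b \in s1) y : b < y -> (y \in S) = (y \in S :\ a).
    move=> b_y; rewrite in_setD1; case: eqVneq => // E.
    by move: (bC b bs); rewrite -E /Order.comparable (ltW b_y) orbT.
  split=> //.
  - apply: (Rao (s := s1)) => //.
    + move=> z; rewrite atomsD1.
        rewrite in_setD1 -sA mem_rcons inE; case: eqVneq => // ->.
        exact/negbTE.
      move=> y yS /(Aa' _ yS)[b bs b_y]; have /atomsP[bS xb _] := As1 b bs.
      exists b; last by rewrite xb.
      by rewrite in_setD1 bS andbT; apply: contraNneq nas1 => <-.
    + by move=> t1 c t2 /s1_split; apply: sB.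
    + move=> t1 c t2 E; apply: eq_rao (sR _ _ _ (s1_split _ _ _ E)); apply: ra.
      by rewrite E mem_cat mem_head orbT.
    move=> t1 c t2 E b y bt; rewrite in_setD1 => /andP[_ yS] b_y cy.
    have [z Az zz] := sC _ _ _ (s1_split _ _ _ E) b y bt yS b_y cy.
    exists z => //; rewrite -(eq_atoms (S := S)) //; apply: ra.
    by rewrite E mem_cat mem_head orbT.
  - exact: rao_comparables_atom Aa (sR _ _ _ ss).
  move=> y yS /(Aa' _ yS)[b bs b_y]; have /atomsP[bS xb _] := As1 b bs.
  exists b; split; rewrite ?xb ?bC // => u uS xu ua.
  by have := Ha u uS xu; rewrite ua.
have [|allA|[v /shed_above]|chainA] := IH _ _ _ ss; first exact: sC ss.
- by apply: Or32; exists a; apply: shed_a.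
- by move=> shv; apply: Or32; exists v.
(* The elements above [a] now form a chain. If there is an earlier atom [b], the common upper bound
   [\top] of [a] and [b] yields an atom above [a] that lies above [s1]; in a chain it is the only
   atom, so [a] can be shed. If there is none, everything above [x] is a chain starting with [a]. *)
case: (pickP (mem s1)) => [b /= bs|s10].
  have bT : b < \top.
    rewrite lt_neqAle lex1 andbT; apply: contraNneq (bC b bs) => ->.
    by rewrite /Order.comparable lex1.
  have [z Az /andP[_ zs]] := sC _ _ _ ss b \top bs topS bT aT.
  apply: Or32; exists a; apply: shed_a; apply/allP=> w; rewrite mem_enum => Aw.
  have /atomsP[zS az _] := Az; have /atomsP[wS aw _] := Aw.
  have /orP[/(atoms_antichain Az Aw)<-//|wz] := chainA z w zS wS az aw.
  by rewrite (atoms_antichain Aw Az wz).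
apply: Or33 => y z yS zS xy xz.
have E u : u \in S -> x < u -> a <= u.
  by move=> uS xu; have [//|[b bs]] := atom_le u uS xu; have := s10 b; rewrite /= bs.
have := E y yS xy; rewrite le_eqVlt => /predU1P[<-|ay].
  by rewrite /Order.comparable E.
have := E z zS xz; rewrite le_eqVlt => /predU1P[<-|az].
  by rewrite comparable_sym /Order.comparable E.
exact: chainA.
Qed.

(** * Complexes of chains, and their vertex decomposition *)

Definition chains_above S x : {set {set P}} :=
  [set C : {set P} | (C \subset [set y in S | x < y < \top]) &&
                     [forall y in C, forall z in C, y >=< z]].

Lemma chains_aboveP S x (C : {set P}) :
  reflect ((forall y, y \in C -> [/\ y \in S, x < y & y < \top]) /\
           {in C &, forall y z, y >=< z})
          (C \in chains_above S x).
Proof.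
rewrite inE; apply: (iffP andP) => -[H1 H2]; split.
- by move=> y /(subsetP H1); rewrite inE => /and3P.
- by move=> y z yC zC; apply: (implyP (forallP (implyP (forallP H2 y) yC) z)).
- by apply/subsetP=> y /H1[yS xy yT]; rewrite inE yS xy.
apply/forallP=> y; apply/implyP=> yC; apply/forallP=> z; apply/implyP=> zC.
exact: H2.
Qed.

Lemma chains_above_complex S x : simplicial_complex (chains_above S x).
Proof.
split; first by apply/chains_aboveP; split=> y; rewrite ?inE // => z; rewrite inE.
move=> F G /chains_aboveP[H1 H2] /subsetP FG; apply/chains_aboveP; split.
  by move=> y /FG/H1.
by move=> y z /FG yG /FG zG; apply: H2.
Qed.

Lemma deletion_chains_above S x v :
  deletion (chains_above S x) v = chains_above (S :\ v) x.
Proof.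
apply/setP=> C; rewrite inE; apply/andP/chains_aboveP=> [[/chains_aboveP[H1 H2] vC]|[H1 H2]].
  split=> // y yC; have [yS xy yT] := H1 y yC; split=> //.
  by rewrite in_setD1 yS andbT; apply: contraNneq vC => <-.
split; last by apply/negP=> /H1[]; rewrite in_setD1 eqxx.
by apply/chains_aboveP; split=> // y /H1[]; rewrite in_setD1 => /andP[].
Qed.

Lemma link_chains_above S x v : v \in S -> x < v -> v < \top ->
  link (chains_above S x) v = chains_above (comparables S v) x.
Proof.
move=> vS xv vT; apply/setP=> C; rewrite inE.
apply/and3P/chains_aboveP=> [[/chains_aboveP[H1 H2] vC /chains_aboveP[_ H3]]|[H1 H2]].
  split=> // y yC; have [yS xy yT] := H1 y yC; split=> //.
  rewrite inE yS H3 ?setU11 ?setU1r // andbT.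
  by apply: contraNneq vC => <-.
have C1 y : y \in C -> [/\ y \in S, x < y & y < \top].
  by move=> /H1[]; rewrite inE => /andP[].
have C2 y : y \in C -> y >=< v by move=> /H1[]; rewrite inE => /and3P[].
split; first by apply/chains_aboveP.
  by apply/negP=> /H1[]; rewrite inE eqxx andbF.
apply/chains_aboveP; split=> [y /setU1P[->//|]|y z]; first exact: C1.
case/setU1P=> [->|yC] /setU1P[->|zC]; first exact: comparablexx.
- by rewrite comparable_sym C2.
- exact: C2.
exact: H2.
Qed.

Lemma sheddable_shedding S x B v :
  \top \in S -> sheddable S x B v -> shedding (chains_above S x) v.
Proof.
move=> topS [[vS xv vT _] _ _ shv] F /chains_aboveP[F1 F2] vF.
(* [y] is the next element of [F] above [v], or [\top] if [v] is the largest element of [F]. *)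
have [y [yS vy yT yF]] : exists y, [/\ y \in S, v < y, y <= \top &
    forall z, z \in F -> v < z -> y <= z].
  have [y0 /andP[y0F vy0]|noF] := pickP [pred z | (z \in F) && (v < z)].
    have [n] := ubnP #|[set z in F | v < z < y0]|.
    elim: n y0 y0F vy0 => // n IHn y0 y0F vy0 le_n.
    have [y1 /and3P[y1F vy1 y1y0]|no] := pickP [pred z | [&& z \in F, v < z & z < y0]].
      apply: (IHn y1) => //; rewrite ltnS in le_n; apply: leq_trans le_n; apply/proper_card/properP; split.
        by apply/subsetP=> u; rewrite !inE => /and3P[-> -> /lt_trans->].
      by exists y1; rewrite !inE ?ltxx ?andbF // y1F vy1 y1y0.
    exists y0; split; rewrite ?lex1 //; first by case: (F1 y0 y0F).
    move=> z zF vz; have := no z; rewrite /= zF vz /= => zy0.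
    by case/orP: (F2 y0 z y0F zF) => //; rewrite le_eqVlt zy0 orbF => /eqP->.
  exists \top; split; rewrite ?lexx // => z zF vz.
  by have := noF z; rewrite /= zF vz.
have [w [wS /andP[xw wy] vw lw]] := shv y yS vy.
have wT : w < \top by apply: lt_le_trans yT.
have wF : w \notin F by apply: contra vw => wF; apply: F2.
exists w; split=> //.
  apply/chains_aboveP; split=> [z /set1P->//|z z' /set1P-> /set1P->].
  exact: comparablexx.
have wC z : z \in F :\ v -> z >=< w.
  rewrite in_setD1 => /andP[zv zF]; have [zS xz zT] := F1 z zF.
  have := F2 z v zF vF; rewrite /Order.comparable => /orP[] H.
    by rewrite (ltW (lw z zS xz _)) // lt_neqAle zv.
  by rewrite (ltW (lt_le_trans wy (yF z zF _))) ?orbT // lt_neqAle eq_sym zv.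
apply/chains_aboveP; split=> [z /setU1P[->//|/setD1P[_]]|z z']; first exact: F1.
case/setU1P=> [->|zF] /setU1P[->|z'F]; first exact: comparablexx.
- by rewrite comparable_sym wC.
- exact: wC.
by case/setD1P: zF => _ zF; case/setD1P: z'F => _; apply: F2.
Qed.

(** Induction on the size of [S] with [x] fixed: the deletion and the link of a sheddable element
    are again complexes of chains above [x], taken in smaller sets that inherit an ordering. *)
Lemma rao_vertex_decomposable S x :
  \top \in S -> rao S x [::] -> vertex_decomposable (chains_above S x).
Proof.
have [n] := ubnP #|S|; elim: n S => // n IHn S le_n topS raoS.
have simplex : (forall y z, y \in S -> z \in S -> x < y -> x < z -> y >=< z) ->
    vertex_decomposable (chains_above S x).
  move=> H; suff -> : chains_above S x = powerset [set y in S | x < y < \top].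
    exact: VD_simplex.
  apply/setP=> C; rewrite inE [RHS]inE andb_idr // => /subsetP CS.
  apply/forallP=> y; apply/implyP=> /CS; rewrite inE => /and3P[yS xy _].
  apply/forallP=> z; apply/implyP=> /CS; rewrite inE => /and3P[zS xz _].
  exact: H.
(* No atom is above the empty list, so the first alternative means that there are no atoms, and
   hence nothing of [S] above [x]. *)
have [//|A0|[v shv]|//] := rao_shed topS raoS.
  apply: simplex => y z yS _ xy; have [w Aw] := atom_below yS xy.
  by have := allP A0 w; rewrite mem_enum Aw => /(_ isT).
have [[vS xv vT _] rD rC _] := shv.
have Sv_n (S' : {set P}) : S' \subset S :\ v -> (#|S'| < n)%N.
  by move=> /subset_leq_card le; move: le_n; rewrite (cardsD1 v S) vS ltnS; apply: leq_trans.
apply: (VD_shed (v := v)).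
- exact: chains_above_complex.
- apply/chains_aboveP; split=> [z /set1P->//|z z' /set1P-> /set1P->].
  exact: comparablexx.
- exact: sheddable_shedding shv.
- rewrite deletion_chains_above; apply: IHn => //; first exact: Sv_n.
  by rewrite in_setD1 topS (gt_eqF vT).
rewrite link_chains_above //; apply: IHn => //.
  by apply: Sv_n; apply/subsetP=> y; rewrite !inE => /and3P[-> ->].
by rewrite inE topS (gt_eqF vT) /Order.comparable lex1 orbT.
Qed.

Lemma order_complexE : order_complex P = chains_above setT \bot.
Proof.
apply/setP=> C; rewrite !inE andbA; congr (_ && _); apply/andP/subsetP.
  move=> [b t] y yC; rewrite !inE /= lt0x ltx1.
  by rewrite (contraNneq _ b) ?(contraNneq _ t) // => <-.
by move=> H; split; apply/negP=> /H; rewrite !inE ltxx ?andbF.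
Qed.

End RecursiveAtomOrderings.

(** * From quasi-CL-labelings to recursive atom orderings *)

Section QuasiCL.
Variables (d dL : Order.disp_t) (P : finTBPOrderType d) (L : orderType dL).
Variable lam : chain_edge_labeling P L.
Implicit Types (x y z a b u v w : P) (r s t A B : seq P).

Lemma mem_atomsT x z : (z \in atoms setT x) = covers x z.
Proof.
apply/atomsP/andP=> [[_ xz H]|[xz /existsPn H]]; split=> //.
  by apply/existsPn=> w; apply/negP=> /andP[xw]; apply/negP/H.
by move=> w _ xw; have := H w; rewrite xw.
Qed.

Lemma covers_lt x z : covers x z -> x < z.
Proof. by case/andP. Qed.

Lemma coversN x z w : covers x z -> x < w -> w < z -> False.
Proof. by case/andP=> _ /existsPn/(_ w) H xw wz; rewrite xw wz in H. Qed.

Lemma labels_cat r s t : labels lam r (s ++ t) = labels lam r s ++ labels lam (r ++ s) t.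
Proof. by elim: s r => [|v s IH] r /=; rewrite ?cats0 // IH cat_rcons. Qed.

Lemma max_chain_cons x y v s : max_chain x y (v :: s) = covers x v && max_chain v y s.
Proof. by rewrite /max_chain /= andbA. Qed.

Lemma root_rcons x r a : Defs.root x r -> covers x a -> Defs.root a (rcons r a).
Proof.
move=> /andP[pr /eqP xr] xa.
by rewrite /Defs.root /max_chain rcons_path pr xr last_rcons eqxx xa.
Qed.

Lemma max_chain_mem x y s z : max_chain x y s -> z \in s -> x < z <= y.
Proof.
elim: s x => // v s IH x; rewrite max_chain_cons => /andP[/covers_lt xv vs].
rewrite inE => /predU1P[->|zs]; last first.
  by have /andP[vz ->] := IH v vs zs; rewrite (lt_trans xv vz).
rewrite xv /=; case: s vs {IH} => [|w s] vs; first by case/andP: vs => _ /eqP/= ->.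
elim: s v w vs {xv} => [|w' s IH] v w; rewrite max_chain_cons => /andP[/covers_lt vw ws].
  by case/andP: ws => _ /eqP/= <-; apply: ltW.
exact: le_trans (ltW vw) (IH _ _ ws).
Qed.

Lemma max_chain_neq_nil x y s : max_chain x y s -> x < y -> exists v t, s = v :: t.
Proof. by case: s => [|v t]; [case/andP=> _ /eqP/= ->; rewrite ltxx | exists v, t]. Qed.

Lemma ascending_cons r v w s :
  weakly_ascending lam r [:: v, w & s] =
    (lam r v <= lam (rcons r v) w) && weakly_ascending lam (rcons r v) (w :: s).
Proof. by []. Qed.

Lemma lex_earlier_cons r v w s t : lex_earlier lam r (v :: s) (w :: t) ->
  lam r v <= lam r w.
Proof. by rewrite /lex_earlier /= ltxi_cons => /andP[]. Qed.

Lemma lex_earlier_cons2 r v w v' w' s t :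
  lex_earlier lam r [:: v, v' & s] [:: w, w' & t] -> lam r v = lam r w ->
  lam (rcons r v) v' <= lam (rcons r w) w'.
Proof.
move=> lt eq; move: lt; rewrite /lex_earlier /= ltxi_cons eq lexx /= ltxi_cons.
by case/andP.
Qed.

Section Facts.
Hypotheses (hlam : quasi_CL_labeling lam) (hrep : no_three_repeated_labels lam).

Lemma ascending_chain x y r : Defs.root x r -> x < y ->
  exists z s, [/\ covers x z, z <= y, max_chain x y (z :: s)
                & weakly_ascending lam r (z :: s)].
Proof.
move=> rx xy; have [A [_ [[s /andP[ms ws]] _ _ _]]] := hlam (ltW xy) rx.
have [z [t E]] := max_chain_neq_nil ms xy; rewrite {}E in ms ws.
exists z, t; split=> //; first by move: ms; rewrite max_chain_cons => /andP[].
by case/andP: (max_chain_mem ms (mem_head z t)).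
Qed.

(** The three covers lie on a maximal chain of [P]: the root leads up to [x], and the labeling
    supplies a maximal chain of the interval from [w] to [\top]. *)
Lemma no_three r x a z w : Defs.root x r -> covers x a -> covers a z -> covers z w ->
  lam r a = lam (rcons r a) z -> lam (rcons r a) z = lam (rcons (rcons r a) z) w ->
  False.
Proof.
move=> rx xa az zw E1 E2.
have rw := root_rcons (root_rcons (root_rcons rx xa) az) zw.
have [_ [_ [[s /andP[/andP[ps ls] _]] _ _ _]]] := hlam (lex1 w) rw.
case/andP: (rw) => pr /eqP lr.
have mc : max_chain \bot \top (rcons (rcons (rcons r a) z) w ++ s).
  by rewrite /max_chain cat_path last_cat pr lr ps.
apply: (negP (hrep mc (lam r a))).
rewrite !cat_rcons labels_cat /= -E2 -E1; apply/infixP.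
by eexists _, _.
Qed.

(* Here [A] is the chain attached to the rooted interval [[x, z]]. *)
Lemma repeated_label_or_mem r x a z A : covers x a -> covers a z ->
  chain_from_to x z A -> {subset x :: A <= [:: x; a; z]} ->
  (forall i, (i < size A)%N -> exists alpha : L, forall u v t,
     nth x (x :: A) i <= u -> covers u v -> v <= nth x A i ->
     max_chain x u t -> {subset take i.+1 (x :: A) <= x :: t} ->
     lam (r ++ t) v = alpha) ->
  lam r a = lam (rcons r a) z \/ a \in A.
Proof.
move=> xa az /andP[pA lA] sA H; have [aA|naA] := boolP (a \in A); [by right|left].
case: A => [|h A] in pA lA sA H naA *.
  by move: lA; rewrite /= => /eqP E; have := lt_trans (covers_lt xa) (covers_lt az);
     rewrite E ltxx.
have xh : x < h by case/andP: pA.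
(* As [a] is not in [A], the first section is all of [[x, z]], so both covers carry its label. *)
have /eqP Eh : h == z.
  have := sA h; rewrite !inE eqxx orbT (gt_eqF xh) /= => /(_ isT)/orP[/eqP E|//].
  by rewrite E mem_head in naA.
have [//|alpha Ha] := H 0%N; rewrite /= Eh in Ha.
have := Ha x a [::]; rewrite cats0 => -> //; last first.
- by rewrite /max_chain /= eqxx.
- exact/ltW/covers_lt.
have := Ha a z [:: a]; rewrite cats1 => -> //.
- exact/ltW/covers_lt.
- by rewrite /max_chain /= xa eqxx.
by move=> u; rewrite !inE => ->.
Qed.

(** The chain through [a] cannot contain the attached chain [A]: its labels differ, so [a] would be
    in [A] and hence on a weakly ascending chain, which is then [x < a < z] itself. So a weakly
    ascending chain [x < b < e < ..] is strictly earlier. A tie between [b] and [a] would make the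
    label of [e] at most that of [z], hence smaller than that of [b]. *)
Lemma descent_earlier_atom r x a z : Defs.root x r -> covers x a -> covers a z ->
  lam (rcons r a) z < lam r a ->
  exists b, [/\ covers x b, b < z & lam r b < lam r a].
Proof.
move=> rx xa az desc; have xz := lt_trans (covers_lt xa) (covers_lt az).
have [A [cA [[s /andP[ms ws]] Hasc Hlab Hlex]]] := hlam (ltW xz) rx.
have mt : max_chain x z [:: a; z] by rewrite /max_chain /= xa az eqxx.
have [b [s' E]] := max_chain_neq_nil ms xz; rewrite {s}E in ms ws.
have sA := Hasc _ ms ws.
move: (ms); rewrite max_chain_cons => /andP[xb ms'].
have bz : b < z.
  rewrite lt_neqAle; have /andP[_ ->] := max_chain_mem ms (mem_head _ _).
  by rewrite andbT; apply/eqP=> E; rewrite E in xb; apply: coversN xb _ (covers_lt az); apply: covers_lt.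
have [e [s'' E]] := max_chain_neq_nil ms' bz; rewrite {s'}E in ms ws sA ms'.
move: ws; rewrite ascending_cons => /andP[be _].
have [/allP At|/allP nAt] := boolP (all (mem [:: x; a; z]) (x :: A)).
  have [E|aA] := repeated_label_or_mem xa az cA At Hlab; first by rewrite E ltxx in desc.
  have : a \in [:: b, e & s''].
    by have := sA a; rewrite !inE aA orbT (gt_eqF (covers_lt xa)) => /(_ isT).
  rewrite inE => /predU1P[E|ae].
    move: ms'; rewrite max_chain_cons => /andP[b_e me].
    case: s'' me {ms sA} => [|f s''] me; last first.
      have /andP[ef fz] := max_chain_mem me (mem_head _ _).
      by case: (coversN az (w := e)); rewrite ?E ?(covers_lt b_e) // (lt_le_trans ef).
    by case/andP: me => _ /eqP/= E'; move: desc; rewrite -E' E ltNge be.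
  have /andP[ba _] := max_chain_mem ms' ae.
  by case: (coversN xa (covers_lt xb) ba).
have lex := Hlex _ _ ms mt sA nAt.
exists b; split=> //; rewrite lt_neqAle (lex_earlier_cons lex) andbT.
apply/eqP=> E; have := lex_earlier_cons2 lex E.
by rewrite leNgt (lt_le_trans desc) // -E.
Qed.

(** The ascending chain contains [A], and [a] is in [A] because the two labels differ. Continue [b]
    by a weakly ascending chain; it misses [a], so it is lexicographically later. If [b] tied with
    [a], it would be weakly ascending from [x] on and so contain [A]. *)
Lemma ascent_later_atoms r x a z b : Defs.root x r -> covers x a -> covers a z ->
  lam r a < lam (rcons r a) z -> covers x b -> b < z -> b != a ->
  lam r a < lam r b.
Proof.
move=> rx xa az asc xb bz ba; have xz := lt_trans (covers_lt xa) (covers_lt az).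
have [A [cA [_ Hasc Hlab Hlex]]] := hlam (ltW xz) rx.
have mt : max_chain x z [:: a; z] by rewrite /max_chain /= xa az eqxx.
have sA : {subset x :: A <= [:: x; a; z]}.
  by apply: Hasc mt _; rewrite /weakly_ascending /= (ltW asc).
have [E|aA] := repeated_label_or_mem xa az cA sA Hlab; first by rewrite E ltxx in asc.
have [e [s [_ _ ms ws]]] := ascending_chain (root_rcons rx xb) bz.
have ms' : max_chain x z [:: b, e & s] by rewrite max_chain_cons xb.
have nA : ~ {subset x :: A <= [:: x, b, e & s]}.
  move=> /(_ a); rewrite in_cons aA orbT => /(_ isT).
  rewrite in_cons (gt_eqF (covers_lt xa)) in_cons eq_sym (negPf ba) /=.
  by move=> /(max_chain_mem ms)/andP[/(coversN xa (covers_lt xb))].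
have lex := Hlex _ _ mt ms' sA nA.
rewrite lt_neqAle (lex_earlier_cons lex) andbT; apply/eqP=> E.
have := lex_earlier_cons2 lex E => le; apply: nA; apply: Hasc ms' _.
by rewrite ascending_cons ws andbT -E (le_trans (ltW asc)).
Qed.

(** [z] is the first step of a weakly ascending chain from [a] to [y]. If it does not descend after
    [a], this chain and one through [b] both contain the chain attached to [[x, y]], whose first
    element then turns out to be [z]. *)
Lemma common_upper_bound r x a b y : Defs.root x r -> covers x a -> covers x b ->
  b != a -> lam r b <= lam r a -> a < y -> b < y ->
  exists z, [/\ covers a z, z <= y & lam (rcons r a) z < lam r a \/ b < z].
Proof.
move=> rx xa xb ba le_ba ay b_y.
have [z [s [az zy ms ws]]] := ascending_chain (root_rcons rx xa) ay.
exists z; split=> //; have [?|asc] := ltP (lam (rcons r a) z) (lam r a); [by left|right].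
have xy := lt_trans (covers_lt xa) ay.
have [A [cA [_ Hasc Hlab Hlex]]] := hlam (ltW xy) rx.
have mt : max_chain x y [:: a, z & s] by rewrite max_chain_cons xa.
have sA : {subset x :: A <= [:: x, a, z & s]}.
  by apply: Hasc mt _; rewrite ascending_cons asc.
have [e [t [_ _ mt' wt]]] := ascending_chain (root_rcons rx xb) b_y.
have mt2 : max_chain x y [:: b, e & t] by rewrite max_chain_cons xb.
(* Otherwise this chain is later than the one through [a]. Then [lam r b <= lam r a] forces equal
   first labels, and comparing the second ones makes this chain weakly ascending, so it contains [A]
   after all. *)
have sA' : {subset x :: A <= [:: x, b, e & t]}.
  have [/allP //|/allP nA] := boolP (all (mem [:: x, b, e & t]) (x :: A)).
  have lex := Hlex _ _ mt mt2 sA nA.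
  have E : lam r a = lam r b by apply/le_anti; rewrite le_ba (lex_earlier_cons lex).
  by apply: Hasc mt2 _; rewrite ascending_cons wt andbT -E (le_trans asc) ?(lex_earlier_cons2 lex).
case/andP: cA => pA lA; case: A => [|h A] in pA lA sA sA' Hlab {Hasc Hlex} *.
  by move: lA xy => /eqP/= ->; rewrite ltxx.
have xh : x < h by case/andP: pA.
have hs : h \in [:: a, z & s].
  by have := sA h; rewrite !in_cons eqxx orbT (gt_eqF xh) => /(_ isT).
have ht : h \in [:: b, e & t].
  by have := sA' h; rewrite !in_cons eqxx orbT (gt_eqF xh) => /(_ isT).
have a_h : h \in z :: s.
  move: hs; rewrite in_cons => /predU1P[E|//]; move: ht; rewrite in_cons E eq_sym (negPf ba).
  by move=> /(max_chain_mem mt')/andP[/(coversN xa (covers_lt xb))].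
have bh : b < h.
  move: ht; rewrite in_cons => /predU1P[E|/(max_chain_mem mt')/andP[//]].
  by move: a_h; rewrite E => /(max_chain_mem ms)/andP[/(coversN xb (covers_lt xa))].
(* [h], the first element of [A], is above both [a] and [b]. Were [z] below [h], the covers
   [x < a < z < w] of the chain would all lie in the first section and share its label. *)
suff -> : z = h by [].
move: a_h; rewrite in_cons => /predU1P[-> //|hs'].
case: s => [//|w s] in ms ws mt sA hs hs' *.
move: (ms); rewrite !max_chain_cons => /and3P[_ zw ms'].
have wh : w <= h.
  by move: hs'; rewrite in_cons => /predU1P[->//|/(max_chain_mem ms')/andP[/ltW]].
have [//|alpha Ha] := Hlab 0%N; rewrite /= in Ha.
have xa' := covers_lt xa; have az' := covers_lt az; have zw' := covers_lt zw.
have sx t0 : {subset [:: x] <= x :: t0} by move=> u; rewrite !inE => ->.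
have La : lam r a = alpha.
  rewrite -[r]cats0; apply: (Ha x) => //; last by rewrite /max_chain /= eqxx.
  exact: ltW (lt_trans az' (lt_le_trans zw' wh)).
have Lz : lam (rcons r a) z = alpha.
  rewrite -cats1; apply: (Ha a) => //; first exact: ltW.
    exact: ltW (lt_le_trans zw' wh).
  by rewrite /max_chain /= xa eqxx.
have Lw : lam (rcons (rcons r a) z) w = alpha.
  rewrite -!cats1 -catA; apply: (Ha z) => //; first exact: ltW (lt_trans xa' az').
  by rewrite /max_chain /= xa az eqxx.
by case: (no_three rx xa az zw); rewrite ?La ?Lz ?Lw.
Qed.

(** The condition on [B] makes sorting by labels compatible with placing atoms above [B] first. In
    the induction it must be re-established above each atom [a], with the atoms preceding [a] in
    place of [B]. *)
Lemma quasi_CL_rao x r B : Defs.root x r ->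
  (forall z w, covers x z -> covers x w -> above B z -> ~~ above B w ->
     lam r z <= lam r w) ->
  rao setT x B.
Proof.
have [n] := ubnP #|[set y | x < y]|; elim: n x r B => // n IHn x r B le_n rx compat.
pose leB a b := (lam r a < lam r b) ||
  ((lam r a == lam r b) && (above B b ==> above B a)).
have leB_total : total leB.
  move=> a b; rewrite /leB; case: ltgtP => //= _.
  by case: (above B a); case: (above B b).
have leB_trans : transitive leB.
  move=> b a c; rewrite /leB => /orP[ab|/andP[/eqP-> ab]].
    by case/orP=> [/(lt_trans ab)->//|/andP[/eqP<-]]; rewrite ab.
  case/orP=> [->//|/andP[-> bc]]; rewrite /=.
  by apply/orP; right; apply/implyP=> /(implyP bc)/(implyP ab).
have leBW a b : leB a b -> lam r a <= lam r b.
  by case/orP=> [/ltW//|/andP[/eqP-> _]].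
pose s := sort leB (enum (atoms setT x)).
have sA : s =i atoms setT x by move=> z; rewrite mem_sort mem_enum.
have Us : uniq s by rewrite sort_uniq enum_uniq.
have sorted_s : sorted leB s by apply: sort_sorted.
have split_s s1 a s2 : s = s1 ++ a :: s2 ->
    [/\ covers x a, a \notin s1, forall b, b \in s1 -> covers x b /\ leB b a &
        forall b, covers x b -> b \notin s1 -> lam r a <= lam r b].
  move=> E; split.
  - by rewrite -mem_atomsT -sA E mem_cat mem_head orbT.
  - by move: Us; rewrite E cat_uniq /= negb_or => /and3P[_ /andP[]].
  - move=> b bs; split; first by rewrite -mem_atomsT -sA E mem_cat bs.
    move: sorted_s; rewrite sorted_pairwise // E pairwise_cat => /andP[/allrelP H _].
    by apply: H; rewrite ?mem_head.
  move=> b; rewrite -mem_atomsT -sA E mem_cat => /orP[->//|].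
  rewrite in_cons => /predU1P[->//|bs _]; apply: leBW.
  move: sorted_s; rewrite sorted_pairwise // E pairwise_cat => /and3P[_ _ /=].
  by case/andP=> /allP/(_ b bs).
apply: (Rao Us sA).
- move=> s1 a s2 E aB; have [xa _ Hs1 _] := split_s _ _ _ E.
  apply/allP=> b bs; have [xb /orP[lt|/andP[_ /implyP/(_ aB)//]]] := Hs1 b bs.
  by apply: contraLR lt => nb; rewrite -leNgt compat.
- move=> s1 a s2 E; have [xa nas1 Hs1 Hs2] := split_s _ _ _ E.
  have ra := root_rcons rx xa.
  apply: IHn ra _ => [|z w az aw zs nws].
    rewrite ltnS in le_n; apply: leq_trans le_n; apply/proper_card/properP; split.
      by apply/subsetP=> y; rewrite !inE; apply: lt_trans (covers_lt xa).
    by exists a; rewrite !inE ?ltxx ?(covers_lt xa).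
  (* If the label of [z] is at most that of [a], then [w] descends after [a] and so lies above an
     atom with a smaller label, which precedes [a]. Otherwise [z] ascends strictly, and the atom of
     [s1] below [z] would have a larger label than [a]. *)
  rewrite leNgt; apply/negP=> wz.
  have [za|az'] := leP (lam (rcons r a) z) (lam r a).
    have [b [xb bw lt]] := descent_earlier_atom rx xa aw (lt_le_trans wz za).
    case/hasP: nws; exists b => //; apply: contraLR lt => nb.
    by rewrite -leNgt Hs2.
  case/hasP: zs => b bs bz; have [xb /leBW] := Hs1 b bs.
  by rewrite leNgt (ascent_later_atoms rx xa az) //; apply: contraNneq nas1 => <-.
move=> s1 a s2 E b y bs _ b_y ay; have [xa nas1 Hs1 Hs2] := split_s _ _ _ E.
have [xb /leBW le_ba] := Hs1 b bs.
have ba : b != a by apply: contraNneq nas1 => <-.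
have [z [az zy Hz]] := common_upper_bound rx xa xb ba le_ba ay b_y.
exists z; first by rewrite mem_atomsT.
(* In the descending case, the atom below [z] with a smaller label than [a] must precede [a] in the
   sorted list. *)
rewrite zy /=; apply/hasP; case: Hz => [lt|bz]; last by exists b.
have [b' [xb' b'z lt']] := descent_earlier_atom rx xa az lt.
by exists b' => //; apply: contraLR lt' => nb; rewrite -leNgt Hs2.
Qed.

End Facts.
End QuasiCL.

Theorem theorem4p11 (d dL : Order.disp_t) (P : finTBPOrderType d)
    (L : orderType dL) (lam : chain_edge_labeling P L)
    (hlam : quasi_CL_labeling lam) (hrep : no_three_repeated_labels lam) :
  vertex_decomposable (order_complex P).
Proof.
rewrite order_complexE; apply: rao_vertex_decomposable; first by rewrite inE.
(* The empty sequence is the root of [\bot]; no atoms precede, so the condition on [B] is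
   vacuous. *)
by apply: (quasi_CL_rao hlam hrep (r := [::])); rewrite // /Defs.root /max_chain /= eqxx.
Qed.
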